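(* Let $n,m\ge 1$ be integers, and let $\mu,\nu\in\mathbb R^n$ and weakly decreasing $\lambda,\bar\lambda\in\mathbb R^m$ satisfy $|\lambda|-|\bar\lambda|+|\mu|-|\nu|=0$. Then a strip-concave parallelogram-wise array $X$ of size $(n,m)$ with $(\lambda^X,\bar\lambda^X,\mu^X,\nu^X)=(\lambda,\bar\lambda,\mu,\nu)$ exists if and only if for each subset $I\subseteq\{1,\ldots,n\}$, the inequality $$\lambda[1,|I|]-\bar\lambda[m-|I|+1,m]+\mu(I)-\nu(I)-\Delta_{|I|}\ge 0$$ holds when $|I|\le m$, and the inequality $$|\lambda|-|\bar\lambda|+\mu(I)-\nu(I)\ge 0$$ holds when $|I|>m$. Furthermore, if $\lambda,\bar\lambda,\mu,\nu$ are integer and the polytope $\mathcal{SC}(\lambda\setminus\bar\lambda,\mu,\nu)$ is nonempty, then it contains an integer point.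
   Context: Parallelogram-wise arrays. For integers $n,m\ge 1$ let $V=\{(i,j)\in\mathbb Z^2: 0\le i\le n,\ 0\le j\le m\}$. A parallelogram-wise array of size $(n,m)$ is a real array $X=(x_{ij})_{(i,j)\in V}\in\mathbb R^V$. Its row derivative is $\partial x_{ij}:=x_{ij}-x_{i,j-1}$ for $0\le i\le n$, $1\le j\le m$. The array $X$ is strip-concave if for all $i=1,\ldots,n$: $\partial x_{ij}\ge \partial x_{i-1,j}$ for $1\le j\le m$, and $\partial x_{i-1,j}\ge\partial x_{i,j+1}$ for $1\le j\le m-1$. $\mathcal{SC}_V$ denotes the set of strip-concave arrays $X\in\mathbb R^V$ with the normalization $x_{00}=0$. Boundary tuples of $X$: $\lambda^X_j:=\partial x_{nj}$ and $\bar\lambda^X_j:=\partial x_{0j}$ ($j=1,\ldots,m$), $\mu^X_i:=x_{i0}-x_{i-1,0}$ and $\nu^X_i:=x_{im}-x_{i-1,m}$ ($i=1,\ldots,n$). $\mathcal{SC}(\lambda\setminus\bar\lambda,\mu,\nu):=\{X\in\mathcal{SC}_V:(\lambda^X,\bar\lambda^X,\mu^X,\nu^X)=(\lambda,\bar\lambda,\mu,\nu)\}$. An integer point is an array with all entries integer. Notation: for a tuple $d=(d_p,\ldots,d_q)$, $|d|$ is the sum of its entries; $d(I):=\sum_{i\in I}d_i$; $d[k,k']:=d_k+\cdots+d_{k'}$ (an empty sum, when $k'=k-1$, is $0$). Deficits: for $k\in\mathbb Z_{\ge 0}$ and $j=1,\ldots,m$, $\delta_k(j):=\max\{0,\bar\lambda_{j-k}-\lambda_j\}$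 if $1\le j-k\le m$, and $\delta_k(j):=0$ otherwise; $\Delta_k:=\sum_{j=1}^{m}\delta_k(j)$. *)

(* Defs.v *)
From mathcomp Require Import all_boot all_order all_algebra.
From mathcomp Require Import classical_sets reals.

Set Implicit Arguments.
Unset Strict Implicit.
Unset Printing Implicit Defensive.

Import Order.TTheory GRing.Theory Num.Theory.

Local Open Scope classical_set_scope.
Local Open Scope ring_scope.

(* An array (x_ij), 0 <= i <= n, 0 <= j <= m, is a matrix in                 *)
(* 'M_(n.+1, m.+1). A tuple d = (d_1, ..., d_p) is a row vector whose        *)
(* entry d_j is d 0 (j - 1), so that j : 'I_p stands for the index j.+1.     *)
Section Arrays.
Context {R : realType} {n m : nat}.
Implicit Types (X : 'M[R]_(n.+1, m.+1)) (lam lamb : 'rV[R]_m) (mu nu : 'rV[R]_n).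

(* Column j : 'I_m of rowder X holds x_(i, j+1) - x_(i, j).                  *)
Definition rowder X : 'M[R]_(n.+1, m) :=
  \matrix_(i, j) (X i (lift ord0 j) - X i (widen_ord (leqnSn m) j)).

Definition strip_concave X : Prop :=
  forall i : 'I_n,
    (forall j : 'I_m,
       rowder X (widen_ord (leqnSn n) i) j <= rowder X (lift ord0 i) j) /\
    (forall j j' : 'I_m, j' = j.+1 :> nat ->
       rowder X (lift ord0 i) j' <= rowder X (widen_ord (leqnSn n) i) j).

Definition bnd_lambda X : 'rV[R]_m := row ord_max (rowder X).

Definition bnd_lambdabar X : 'rV[R]_m := row ord0 (rowder X).

Definition bnd_mu X : 'rV[R]_n :=
  \row_i (X (lift ord0 i) ord0 - X (widen_ord (leqnSn n) i) ord0).

Definition bnd_nu X : 'rV[R]_n :=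
  \row_i (X (lift ord0 i) ord_max - X (widen_ord (leqnSn n) i) ord_max).

Definition boundary X : 'rV[R]_m * 'rV[R]_m * 'rV[R]_n * 'rV[R]_n :=
  (bnd_lambda X, bnd_lambdabar X, bnd_mu X, bnd_nu X).

Definition SCV : set 'M[R]_(n.+1, m.+1) :=
  [set X | strip_concave X /\ X ord0 ord0 = 0].

Definition SC lam lamb mu nu : set 'M[R]_(n.+1, m.+1) :=
  [set X | SCV X /\ boundary X = (lam, lamb, mu, nu)].

End Arrays.

Section Tuples.
Context {R : realType} {p : nat}.
Implicit Types d : 'rV[R]_p.

Definition weakly_decreasing d : Prop :=
  forall j j' : 'I_p, (j <= j')%N -> d 0 j' <= d 0 j.

Definition sum_all d : R := \sum_(j < p) d 0 j.

Definition sum_on d (I : {set 'I_p}) : R := \sum_(i in I) d 0 i.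

(* d[k, k'] = d_k + ... + d_k', with the bounds counted from 1.              *)
Definition sum_seg d (k k' : nat) : R := \sum_(j < p | (k <= j.+1 <= k')%N) d 0 j.

End Tuples.

Section Deficits.
Context {R : realType} {m : nat}.
Implicit Types lam lamb : 'rV[R]_m.

Definition ord_subn (j : 'I_m) (k : nat) : 'I_m :=
  Ordinal (leq_ltn_trans (leq_subr k j) (ltn_ord j)).

(* With indices counted from 1, j.+1 - k is in [1, m] exactly when k <= j.   *)
Definition deficit lam lamb (k : nat) (j : 'I_m) : R :=
  if (k <= j)%N then Num.max 0 (lamb 0 (ord_subn j k) - lam 0 j) else 0.

Definition total_deficit lam lamb (k : nat) : R :=
  \sum_(j < m) deficit lam lamb k j.

End Deficits.

(* Main.v *)
Require Import Defs.
From mathcomp Require Import classical_sets reals.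
From mathcomp Require Import all_boot all_order all_algebra lra zify.

Set Implicit Arguments.
Unset Strict Implicit.
Unset Printing Implicit Defensive.

Import Order.TTheory GRing.Theory Num.Theory.

Local Open Scope ring_scope.

(** Write [P_i] for the sequence of row derivatives of row [i]. Strip-concavity
    says that [P_i] and [P_(i+1)] interlace, so that an array is a chain
    [lamb = P_0, ..., P_n = lam] of nested weakly decreasing sequences whose
    successive differences are horizontal strips, the [i]-th of total size
    [c_i = nu_i - mu_i]: a real skew Gelfand-Tsetlin pattern of weight [c].

    Think of the region between two decreasing sequences [b <= u] as made of
    vertical columns, one for each real abscissa, and let [h] be the column
    height. A strip meets each column at most once, hence [k] strips cover at
    most the integral of [min(h, k)], and they leave at least the integral of
    [max(0, h - k)]. Reading the latter row by row gives [excess u b k]. The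
    strips indexed by a set [J] must therefore cover at least what the
    [n - |J|] others leave:

       [excess lam lamb (n - |J|) <= sum of c over J]   for every [J].

    For [J] the complement of [I], these are the inequalities of the theorem
    once the identity [max(0, x) = x + max(0, - x)] is applied to each term of
    the excess ([dominance_excess], [inequalities_excess]).

    Necessity ([pattern_excess]) is an induction on the number of rows. If the
    last strip belongs to [J], removing it decreases the excess by at most its
    size ([excess_strip]). Otherwise removing it also removes one strip from
    the complement of [J], and the excess with parameter [k + 1] before is at
    most the excess with parameter [k] after ([excess_shift]).

    Sufficiency ([pattern_exists]) peels off the last strip, of prescribed
    size [c_n], greedily from the tallest columns ([peel_strip]). For some
    threshold [t], every column of height more than [t + 1] loses a box, some
    of height exactly [t + 1] do, and no lower one does. For [k > t] this
    achieves equality in [excess_shift] ([excess_peel_high]), and for [k <= t]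
    it achieves equality in [excess_strip] ([excess_peel_low]). In both cases
    the inequality for [J] and the shorter chain is one of the inequalities for
    the longer chain, with [J] or with [J] and the last index.

    The peeled sequence is built from the data by subtractions and by binary
    maxima and minima, so it stays in any additive subgroup that contains the
    data. Applied to the integers, this gives the integer point. *)

(** * Interlacing sequences and their excess *)

Section Strips.
Variables (R : realDomainType) (m : nat).
Implicit Types (u v b : nat -> R) (S : zmodClosed R).

Definition decreasing_below u : Prop :=
  forall j j', (j <= j')%N -> (j' < m)%N -> u j' <= u j.

Definition interlace u v : Prop :=
  (forall j, (j < m)%N -> v j <= u j) /\
  (forall j, (j.+1 < m)%N -> u j.+1 <= v j).

(** For decreasing [b <= u], the integral of [max(0, h - k)] over the columns
    between [b] and [u], [h] being the height: row
    [j] contributes the length of the abscissas of [[b_(j - k), u_j[], at which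
    row [j] is more than [k] boxes deep. *)
Definition excess u b (k : nat) : R :=
  \sum_(k <= j < m) Num.max 0 (u j - b (j - k)%N).

Lemma decreasing_below_succ u :
  (forall j, (j.+1 < m)%N -> u j.+1 <= u j) -> decreasing_below u.
Proof.
move=> uS j j' /subnK <-; elim: (j' - j)%N => [|d IHd] //= ltm.
by rewrite addSn in ltm *; exact: le_trans (uS _ ltm) (IHd (ltnW ltm)).
Qed.

Lemma excess_ge0 u b k : 0 <= excess u b k.
Proof. by apply: sumr_ge0 => j _; rewrite le_max lexx. Qed.

(** [max(0, x)] is 1-Lipschitz and nondecreasing in [x], term by term. *)
Lemma excess_strip u v b k : interlace u v ->
  excess u b k <= excess v b k + \sum_(0 <= j < m) (u j - v j).
Proof.
case=> vu _; rewrite /excess.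
have [mk|/ltnW km] := leqP m k.
  rewrite [leLHS]big_geq // [X in _ <= X + _]big_geq // add0r big_nat.
  apply: sumr_ge0 => j /andP[_ jm].
  by rewrite subr_ge0 vu.
rewrite (big_cat_nat (leq0n k) km) /= addrCA -big_split /=.
rewrite -[leLHS]add0r; apply: lerD.
  rewrite big_nat; apply: sumr_ge0 => j /andP[_ jk].
  by rewrite subr_ge0 vu // (leq_trans jk).
apply: ler_sum_nat => j /andP[_ jm]; have := vu j jm.
by rewrite /Num.max; case: ifP; case: ifP; rewrite ?ltNge; lra.
Qed.

(** Interlacing bounds row [j + 1] of [u] by row [j] of [v], and both are
    compared with the same entry of [b]. *)
Lemma excess_shift u v b k : interlace u v -> excess u b k.+1 <= excess v b k.
Proof.
case=> _ uv; rewrite /excess; have [mk|km] := leqP m k.+1.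
  by rewrite big_geq //; exact: excess_ge0.
case: m uv km => // m' uv km; rewrite big_add1 /= big_nat_recr //=; last by lia.
rewrite -[leLHS]addr0; apply: lerD; last by rewrite le_max lexx.
apply: ler_sum_nat => j /andP[kj jm]; rewrite subSS.
have uvj : u j.+1 - b (j - k)%N <= v j - b (j - k)%N by rewrite lerB // uv.
by rewrite ge_max !le_max lexx uvj orbT.
Qed.

(** The positive parts of [u_j - b_j] sum to at least the sum of the
    [u_j - b_j]; equality forces each difference to be nonnegative. *)
Lemma excess0_tight u b :
  excess u b 0 <= \sum_(0 <= j < m) u j - \sum_(0 <= j < m) b j ->
  forall j, (j < m)%N -> b j <= u j.
Proof.
rewrite /excess -sumrB -subr_le0 -sumrB big_mkord => tight j jm.
have term_ge0 (i : 'I_m) : true ->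
    0 <= Num.max 0 (u i - b (i - 0)%N) - (u i - b i).
  by move=> _; rewrite subn0 subr_ge0 le_max lexx orbT.
have /eqP : \sum_(i < m) (Num.max 0 (u i - b (i - 0)%N) - (u i - b i)) = 0.
  by apply/le_anti; rewrite tight sumr_ge0.
rewrite psumr_eq0 // => /allP /(_ (Ordinal jm)).
rewrite mem_index_enum => /(_ isT) /=; rewrite subn0 subr_eq0 => /eqP ub.
by rewrite -subr_ge0 -ub le_max lexx.
Qed.

(** What remains of [u] after removing the bottom box of every column: a
    column of height [h] keeps [max(0, h - 1)] boxes above [b]. *)
Lemma excess1_sum u b :
  \sum_(0 <= j < m) (if (j.+1 < m)%N then Num.max (u j.+1) (b j) else b j)
  = \sum_(0 <= j < m) b j + excess u b 1.
Proof.
rewrite /excess; case: m => [|m']; first by rewrite !big_geq ?addr0.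
rewrite !(big_nat_recr m' 0) //= ltnn big_add1 /= addrAC; congr (_ + _).
rewrite -big_split /=; apply: eq_big_nat => j /andP[_ jm]; rewrite subn1 /= ltnS jm /=.
by rewrite addr_maxr addr0 maxC subrKC.
Qed.

End Strips.

(** * Intermediate sums *)

(** An intermediate value theorem for sums over a box. Taking each entry as
    small as the remaining ones permit keeps the solution inside any additive
    subgroup containing the data, which a convex combination would not. *)
Lemma sum_between (R : realDomainType) (S : zmodClosed R) (m : nat)
    (a z : nat -> R) (s : R) :
  (forall j, (j < m)%N -> a j <= z j) ->
  \sum_(0 <= j < m) a j <= s <= \sum_(0 <= j < m) z j ->
  exists v, [/\ forall j, (j < m)%N -> a j <= v j <= z j,
    \sum_(0 <= j < m) v j = s &
    (forall j, (j < m)%N -> a j \in S) -> (forall j, (j < m)%N -> z j \in S) ->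
      s \in S -> forall j, (j < m)%N -> v j \in S].
Proof.
elim: m s => [|m IHm] s az.
  rewrite !big_geq // => /le_anti s0.
  by exists a; split => //; rewrite big_geq.
rewrite !big_nat_recr //= => /andP[as_ sz].
have azm := az m (ltnSn m).
have azs : \sum_(0 <= j < m) a j <= \sum_(0 <= j < m) z j.
  by apply: ler_sum_nat => j /andP[_ jm]; apply: az; lia.
(* The least last entry for which the other entries can reach the sum. *)
pose x := Num.max (a m) (s - \sum_(0 <= j < m) z j).
have xP : [/\ a m <= x <= z m, \sum_(0 <= j < m) a j <= s - x &
              s - x <= \sum_(0 <= j < m) z j].
  rewrite /x; case: (leP (a m) (s - _)) => h.
    by split; first (apply/andP; split); lra.
  by split; first (apply/andP; split); lra.
case: xP => xaz sxa sxz.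
have [|w [waz ws wS]] := IHm (s - x) (fun j jm => az j (ltnW jm)).
  by rewrite sxa.
exists (fun j => if j == m then x else w j); split.
- move=> j; rewrite ltnS leq_eqVlt; case: eqP => [-> //|_ /= jm]; exact: waz.
- rewrite big_nat_recr //= eqxx -[RHS](subrK x) -ws; congr (_ + _); apply: eq_big_nat => j jm.
  by rewrite ltn_eqF.
move=> aS zS sS.
have xS : x \in S.
  rewrite /x; case: leP => _; first rewrite rpredB // big_nat rpred_sum // => j jm.
    by apply: zS; lia.
  exact: aS.
move=> j; rewrite ltnS leq_eqVlt; case: eqP => [//|_ /= jm].
apply: wS => //; last by rewrite rpredB.
- by move=> i im; apply: aS; lia.
- by move=> i im; apply: zS; lia.
Qed.

Lemma discrete_ivt (R : realDomainType) (F : nat -> R) p s :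
  F 0 <= s <= F p.+1 -> exists t, F t <= s <= F t.+1.
Proof.
elim: p => [|p IHp] /andP[F0 Fp]; first by exists 0%N; rewrite F0.
have [sF|Fs] := leP s (F p.+1); first by apply: IHp; rewrite F0.
by exists p.+1; rewrite ltW.
Qed.

(** * Peeling a strip off the tallest columns *)

Section Peeling.
Variables (R : realDomainType) (m : nat).
Implicit Types (u v b : nat -> R) (S : zmodClosed R).

(** Row [j] after removing the bottom box of every column of height more than
    [t]: a column that ends in row [j] has height more than [t] when its
    abscissa is below [u_j] and at least [b_(j - t)]. A strip
    cannot cut row [j] below the former length of row [j + 1], hence the
    maximum. *)
Definition greedy u b (t j : nat) : R :=
  if (j < t)%N then u j else
  let low := Num.min (u j) (b (j - t)%N) in
  if (j.+1 < m)%N then Num.max (u j.+1) low else low.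

Lemma greedy_le u b t j : decreasing_below m u -> (j < m)%N ->
  greedy u b t j <= u j.
Proof.
move=> ud jm; rewrite /greedy; case: ifP => // _.
by case: ifP => jm1; rewrite ?ge_max ge_min lexx // ud.
Qed.

Lemma greedy_ge u b t j : decreasing_below m u -> (j.+1 < m)%N ->
  u j.+1 <= greedy u b t j.
Proof.
by move=> ud jm; rewrite /greedy; case: ifP => _; rewrite ?jm ?ud ?le_max ?lexx.
Qed.

Lemma greedy_homo u b t j : decreasing_below m u -> decreasing_below m b ->
  (j < m)%N -> greedy u b t j <= greedy u b t.+1 j.
Proof.
move=> ud bd jm; rewrite {2}/greedy; case: ifP => [_|jt]; first exact: greedy_le.
rewrite /greedy ifF; last by lia.
have low_le : Num.min (u j) (b (j - t)%N) <= Num.min (u j) (b (j - t.+1)%N).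
  by rewrite le_min !ge_min lexx bd ?orbT //; lia.
by case: ifP => // _; rewrite ge_max !le_max lexx low_le orbT.
Qed.

Lemma greedy_mem S u b t j : (forall i, (i < m)%N -> u i \in S) ->
  (forall i, (i < m)%N -> b i \in S) -> (j < m)%N -> greedy u b t j \in S.
Proof.
move=> uS bS jm; rewrite /greedy; case: ifP => _; first exact: uS.
have lowS : Num.min (u j) (b (j - t)%N) \in S.
  by rewrite /Num.min; case: ifP => _; [apply: uS | apply: bS; lia].
by case: ifP => // jm1; rewrite /Num.max; case: ifP => _ //; apply: uS.
Qed.

(** When every column of height more than [t + 1] has lost a box, the excess
    over any [k > t] is that of the original columns over [k + 1]. Rowwise, the
    entry [b_(j - t - 1)] occurring in [greedy] is at most [b_(j - k)], so only
    the part of [v_j] coming from [u_(j + 1)] can exceed [b_(j - k)]. *)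
Lemma excess_peel_high u v b t k : decreasing_below m b ->
  (forall j, (j < m)%N -> v j <= greedy u b t.+1 j) -> (t < k)%N ->
  excess m v b k <= excess m u b k.+1.
Proof.
move=> bd vg tk; rewrite /excess; have [mk|km] := leqP m k.
  by rewrite big_geq //; exact: excess_ge0.
have low_le j : (k <= j < m)%N -> Num.min (u j) (b (j - t.+1)%N) <= b (j - k)%N.
  by move=> kjm; rewrite ge_min [X in _ || X]bd ?orbT //; lia.
have [m' mE] : exists m', m = m'.+1 by exists m.-1; lia.
rewrite mE in km low_le; rewrite {1 2}mE.
rewrite big_add1 /= big_nat_recr //= -[leRHS]addr0; apply: lerD.
  apply: ler_sum_nat => j /andP[kj jm]; rewrite subSS.
  have := vg j; rewrite /greedy mE [(j.+1 < _)%N]ltnS jm (ltnW jm : j < m'.+1)%N ifF; last by lia.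
  have := low_le j; rewrite kj (ltnW jm : j < m'.+1)%N => /(_ isT) low_j /(_ isT).
  rewrite le_max ge_max !le_max lexx /= lerD2r.
  case/orP=> [->|/le_trans/(_ low_j) vb]; first by rewrite orbT.
  by rewrite subr_le0 vb.
rewrite ge_max lexx /= subr_le0.
have := vg m'; rewrite /greedy mE ltnSn ltnn ifF; last by lia.
by move=> /(_ isT) /le_trans; apply; apply: low_le; rewrite ltnSn andbT.
Qed.

(** When only columns of height more than [t] have lost a box, each removed
    box counts in the excess over any [k <= t]: a row that has shrunk still
    satisfies [b_(j - k) <= b_(j - t) <= v_j], so that both positive parts are
    plain differences. *)
Lemma excess_peel_low u v b t k : decreasing_below m b -> 
  (forall j, (j < m)%N -> greedy u b t j <= v j <= u j) -> (k <= t)%N ->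
  excess m v b k <= excess m u b k - \sum_(0 <= j < m) (u j - v j).
Proof.
move=> bd gv kt; rewrite /excess; have [mk|/ltnW km] := leqP m k.
  rewrite ![\sum_(k <= _ < _) _]big_geq // sub0r oppr_ge0.
  rewrite big_nat sumr_le0 // => j /andP[_ jm].
  by have := gv j jm; rewrite /greedy ifT ?subr_le0; [case/andP | lia].
rewrite [X in _ - X](big_cat_nat (leq0n k) km) /= [X in _ - (X + _)]big_nat.
rewrite [X in _ - (X + _)]big1 ?add0r; last first.
  move=> j /andP[_ jk]; have := gv j (leq_trans jk km).
  by rewrite /greedy ifT; [move/le_anti-> ; rewrite subrr | lia].
rewrite -sumrB; apply: ler_sum_nat => j /andP[kj jm].
have /andP[gvj vu] := gv j jm.
(* A row that has not shrunk contributes the same to both excesses. *)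
have [->|vuN] := eqVneq (v j) (u j); first by rewrite subrr subr0.
have {}vu : v j < u j by rewrite lt_neqAle vuN.
have bv : b (j - k)%N <= v j.
  move: gvj; rewrite /greedy; case: ifP => jt; first by rewrite leNgt vu.
  have bb : b (j - k)%N <= b (j - t)%N by apply: bd; lia.
  move=> gvj; apply: le_trans bb _.
  have : Num.min (u j) (b (j - t)%N) <= v j.
    by move: gvj; case: ifP => // _; rewrite ge_max => /andP[].
  by rewrite ge_min leNgt vu.
by rewrite !max_r ?subr_ge0 //; lra.
Qed.

(** The hypothesis [b + excess u b 1 <= u - c], on sums, says that removing
    one box from every column suffices to reach the size [c]. The size of the
    strip removed by [greedy] is monotone in the threshold, so [c] lies between
    two consecutive thresholds, and [sum_between] interpolates there. *)
Lemma peel_strip S u b c : decreasing_below m u -> decreasing_below m b ->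
  (forall j, (j < m)%N -> b j <= u j) -> 0 <= c ->
  \sum_(0 <= j < m) b j + excess m u b 1 <= \sum_(0 <= j < m) u j - c ->
  exists v, exists t, [/\ interlace m u v,
    \sum_(0 <= j < m) v j = \sum_(0 <= j < m) u j - c,
    forall k, (t < k)%N -> excess m v b k <= excess m u b k.+1,
    forall k, (k <= t)%N -> excess m v b k <= excess m u b k - c &
    (forall j, (j < m)%N -> u j \in S) -> (forall j, (j < m)%N -> b j \in S) ->
      c \in S -> forall j, (j < m)%N -> v j \in S].
Proof.
move=> ud bd bu c0 room; pose G t := \sum_(0 <= j < m) greedy u b t j.
have G0 : G 0 = \sum_(0 <= j < m) b j + excess m u b 1.
  rewrite -excess1_sum; apply: eq_big_nat => j jm.
  by rewrite /greedy /= subn0 min_r // bu.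
(* At threshold [m + 1] no column is tall enough, and nothing is removed. *)
have Gm : G m.+1 = \sum_(0 <= j < m) u j.
  by apply: eq_big_nat => j /andP[_ jm]; rewrite /greedy ifT // ltnW.
have [|t Gt] := @discrete_ivt _ G m (\sum_(0 <= j < m) u j - c).
  by rewrite G0 room Gm gerBl.
have [v [gvg vsum vS]] :=
  sum_between S (fun j => greedy_homo t ud bd) Gt.
have gvu j : (j < m)%N -> greedy u b t j <= v j <= u j.
  move=> jm; have /andP[-> /= /le_trans] := gvg j jm; apply; exact: greedy_le.
exists v, t; split=> //.
- split=> j jm; first by case/andP: (gvu j jm).
  by have /andP[/(le_trans _)->] := gvu j (ltnW jm); rewrite ?greedy_ge.
- by move=> k; apply: excess_peel_high => // j /gvg /andP[].
- move=> k kt; have := excess_peel_low bd gvu kt; rewrite sumrB vsum; lra.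
move=> uS bS cS; apply: vS => [j jm|j jm|]; [exact: greedy_mem..|].
by rewrite rpredB // big_nat rpred_sum // => j /andP[_ /uS].
Qed.

End Peeling.

(** * Existence of chains of strips *)

Section Patterns.
Variables (R : realDomainType) (m n : nat) (c : 'I_n -> R).
Implicit Types (P : nat -> nat -> R) (J : {set 'I_n}).

Definition strip_step P (i : 'I_n) : Prop :=
  interlace m (P i.+1) (P i) /\
  \sum_(0 <= j < m) P i.+1 j - \sum_(0 <= j < m) P i j = c i.

Definition before (r : nat) : {set 'I_n} := [set i : 'I_n | (i < r)%N].

Lemma card_before r : (r <= n)%N -> #|before r| = r.
Proof.
move=> rn; rewrite cardsE -sum1_card -(big_ord_widen _ (fun=> 1%N)) //.
by rewrite sum1_card card_ord.
Qed.

Lemma leq_card_before r J : (r <= n)%N -> J \subset before r -> (#|J| <= r)%N.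
Proof. by move=> rn /subset_leq_card; rewrite card_before. Qed.

Lemma before0 : before 0 = set0.
Proof. by apply/setP => i; rewrite !inE. Qed.

Lemma beforeS (i : 'I_n) : before i.+1 = i |: before i.
Proof. by apply/setP => i'; rewrite !inE ltnS leq_eqVlt. Qed.

Lemma notin_before (i : 'I_n) J : J \subset before i -> i \notin J.
Proof. by move=> /subsetP Ji; apply/negP => /Ji; rewrite inE ltnn. Qed.

(** Necessity: [r - #|J|] strips lie outside [J]; each of them lowers the
    parameter of the excess by one, and each strip in [J] lowers the excess by
    at most its size. *)
Lemma pattern_excess P r J : (r <= n)%N ->
  (forall i : 'I_n, (i < r)%N -> strip_step P i) -> J \subset before r ->
  excess m (P r) (P 0%N) (r - #|J|) <= \sum_(i in J) c i.
Proof.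
elim: r J => [|r IHr] J rn step Jr.
  rewrite before0 subset0 in Jr; rewrite (eqP Jr) cards0 big_set0 /excess.
  by rewrite big1 // => j _; rewrite !subn0 subrr maxxx.
pose i := Ordinal rn; have [il ic] := step i (ltnSn r).
have {}IHr J' : J' \subset before r -> 
    excess m (P r) (P 0%N) (r - #|J'|) <= \sum_(i in J') c i.
  by apply: IHr (ltnW rn) _ => i' i'r; apply: step; exact: leqW.
rewrite (beforeS i) in Jr.
have [iJ|iJ] := boolP (i \in J).
  have Jr' : J :\ i \subset before r by rewrite subDset.
  rewrite (cardsD1 i) iJ add1n subSS (big_setD1 i) //= addrC -ic.
  by rewrite (le_trans (excess_strip _ _ il)) // sumrB lerD2r IHr.
have Jr' : J \subset before r.
  apply/subsetP => x xJ; have /subsetP/(_ x xJ) := Jr.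
  by case/setU1P => // xi; rewrite -xi xJ in iJ.
by rewrite subSn ?leq_card_before ?(ltnW rn) // (le_trans (excess_shift _ _ il)) ?IHr.
Qed.

(** Sufficiency, by peeling. The inequalities used before peeling the strip
    [i] are those for [[set i]] (its size is nonnegative), for all the indices
    ([b] lies below [u]), and for all indices but [i] (there is room for the
    strip). *)
Lemma pattern_exists (S : zmodClosed R) b : decreasing_below m b ->
  forall r u, (r <= n)%N -> decreasing_below m u ->
  \sum_(0 <= j < m) u j - \sum_(0 <= j < m) b j = \sum_(i in before r) c i ->
  (forall J, J \subset before r -> 
     excess m u b (r - #|J|) <= \sum_(i in J) c i) ->
  exists P, [/\ P r = u, forall j, (j < m)%N -> P 0%N j = b j,
    forall i : 'I_n, (i < r)%N -> strip_step P i &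
    (forall j, (j < m)%N -> u j \in S) -> (forall j, (j < m)%N -> b j \in S) ->
    (forall i, c i \in S) ->
    forall i j, (i <= r)%N -> (j < m)%N -> P i j \in S].
Proof.
move=> bd; elim=> [|r IHr] u rn ud ucsum Hu.
  have ub0 : excess m u b 0 <= 0.
    by have := Hu set0 (sub0set _); rewrite cards0 big_set0.
  have bu : forall j, (j < m)%N -> b j <= u j.
    by apply: excess0_tight; rewrite ucsum before0 big_set0.
  exists (fun=> u); split=> //; last by move=> uS _ _ _ j _; exact: uS.
  move=> j jm; apply/le_anti; rewrite bu // andbT -subr_le0.
  apply: le_trans ub0; rewrite /excess big_mkord (bigD1 (Ordinal jm)) //= subn0.
  rewrite -[leLHS]addr0; apply: lerD; first by rewrite le_max lexx orbT.
  by apply: sumr_ge0 => j' _; rewrite le_max lexx.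
pose i := Ordinal rn.
have iNr : i \notin before r by exact: notin_before (subxx _).
have bS : before r.+1 = i |: before r by exact: (beforeS i).
rewrite bS in ucsum Hu; rewrite big_setU1 //= in ucsum.
have card_r : #|before r| = r by rewrite card_before // ltnW.
have c0 : 0 <= c i.
  have := Hu [set i]; rewrite sub1set setU11 big_set1 => /(_ isT).
  exact/le_trans/excess_ge0.
have bu : forall j, (j < m)%N -> b j <= u j.
  apply: excess0_tight; rewrite ucsum -big_setU1 //.
  by have := Hu _ (subxx _); rewrite cardsU1 iNr card_r subnn.
have room : \sum_(0 <= j < m) b j + excess m u b 1
    <= \sum_(0 <= j < m) u j - c i.
  have := Hu _ (subsetUr _ _); rewrite card_r subSnn; lra.
have [v [t [uv vsum high low vS]]] := peel_strip S ud bd bu c0 room.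
have vd : decreasing_below m v.
  case: uv => vu uv; apply: decreasing_below_succ => j jm.
  by rewrite (le_trans (vu _ jm)) ?uv.
have [|J Jr|P [Pr P0 Pstep PS]] := IHr v (ltnW rn) vd.
- rewrite vsum; lra.
- have Jr_le := leq_card_before (ltnW rn) Jr.
  (* Above the threshold the inequality for [J] and [u] is enough, the index
     [i] counting as one more strip outside [J]; below, it is that for
     [i |: J]. *)
  have [tk|kt] := ltnP t (r - #|J|).
    apply: le_trans (high _ tk) _; rewrite -subSn //; apply: Hu.
    exact: subset_trans Jr (subsetUr _ _).
  apply: le_trans (low _ kt) _; rewrite lerBlDr addrC.
  have iJ := notin_before (i := i) Jr.
  have := Hu (i |: J) (setUS _ Jr); rewrite big_setU1 //= cardsU1 iJ.
  by rewrite add1n subSS.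
exists (fun k => if k == r.+1 then u else P k); split=> //.
- by rewrite eqxx.
- move=> i'; rewrite ltnS leq_eqVlt /strip_step => /orP[/eqP i'r|i'r].
    have -> : i' = i by apply: val_inj.
    rewrite eqxx ltn_eqF //= Pr; split=> //; rewrite vsum; lra.
  by rewrite eqSS (ltn_eqF i'r) (ltn_eqF (leqW i'r)); exact: Pstep.
move=> uS bS' cS k j; rewrite leq_eqVlt; case: eqP => [_ _ /uS //|_ /= kr jm].
by apply: PS => //; apply: vS => //; exact: cS.
Qed.

End Patterns.

(** * The inequalities in terms of the excess *)

Section Rows.
Variables (R : realType) (p : nat).
Implicit Types d e : 'rV[R]_p.+1.

(** [inord] makes row vectors into sequences indexed by [nat]; only the
    values below the length are ever relevant. *)
Definition entry d (j : nat) : R := d 0 (inord j).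

Lemma entry_ord d (j : 'I_p.+1) : entry d j = d 0 j.
Proof. by rewrite /entry inord_val. Qed.

Lemma sum_allE d : sum_all d = \sum_(0 <= j < p.+1) entry d j.
Proof. by rewrite big_mkord; apply: eq_bigr => j _; rewrite entry_ord. Qed.

Lemma sum_seg_prefix d k : (k <= p.+1)%N ->
  sum_seg d 1 k = \sum_(0 <= j < k) entry d j.
Proof.
move=> kp; rewrite /sum_seg (big_nat_widen _ _ _ _ _ kp) big_mkord.
by apply: eq_big => // j _; rewrite entry_ord.
Qed.

Lemma sum_seg_suffix d k :
  sum_seg d k.+1 p.+1 = \sum_(k <= j < p.+1) entry d j.
Proof.
rewrite /sum_seg (big_nat_widenl k 0) // big_mkord.
by apply: eq_big => [j|j _]; rewrite ?entry_ord // ltnS ltn_ord andbT.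
Qed.

Lemma decreasing_entry d : weakly_decreasing d -> decreasing_below p.+1 (entry d).
Proof.
move=> dd j j' jj' j'p; apply: dd; rewrite !inordK //.
exact: leq_ltn_trans j'p.
Qed.

Lemma total_deficitE d e k :
  total_deficit d e k
  = \sum_(k <= j < p.+1) Num.max 0 (entry e (j - k) - entry d j).
Proof.
rewrite /total_deficit (big_nat_widenl k 0) // big_mkord big_mkcond /=.
rewrite [RHS]big_mkcond; apply: eq_bigr => j _; rewrite /deficit.
by case: ifP => // kj; rewrite entry_ord -entry_ord.
Qed.

(** The sum of the differences [d_j - e_(j - k)] over [k <= j] is the excess
    minus the total deficit, by [x = max(0, x) - max(0, - x)]. *)
Lemma dominance_excess d e k : (k <= p.+1)%N ->
  sum_seg d 1 k - sum_seg e (p.+1 - k + 1) p.+1 - total_deficit d e k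
  = sum_all d - sum_all e - excess p.+1 (entry d) (entry e) k.
Proof.
move=> kp; rewrite addn1 sum_seg_prefix // sum_seg_suffix total_deficitE !sum_allE.
rewrite (big_cat_nat (leq0n k) kp) /= (big_cat_nat (leq0n (p.+1 - k)) (leq_subr _ _)) /=.
have -> : \sum_(0 <= j < p.+1 - k) entry e j
        = \sum_(k <= j < p.+1) entry e (j - k).
  rewrite -{2}[k]add0n big_addn; apply: eq_bigr => j _; by rewrite addnK.
have -> : excess p.+1 (entry d) (entry e) k =
    \sum_(k <= j < p.+1) entry d j - \sum_(k <= j < p.+1) entry e (j - k)
    + \sum_(k <= j < p.+1) Num.max 0 (entry e (j - k) - entry d j).
  rewrite /excess -sumrB -big_split; apply: eq_bigr => j _ /=.
  by case: (leP 0 (entry d j - _)); case: (leP 0 (entry e _ - _)); lra.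
lra.
Qed.

End Rows.

(** * Arrays and chains of rows *)

Section Arrays.
Variables (R : realType) (n m : nat).
Implicit Types (X : 'M[R]_(n.+2, m.+2)) (lam lamb : 'rV[R]_m.+1) (mu nu : 'rV[R]_n.+1).

Definition array_rows X (i j : nat) : R := rowder X (inord i) (inord j).

Definition increment mu nu (i : 'I_n.+1) : R := nu 0 i - mu 0 i.

Definition skew_pattern lam lamb mu nu (P : nat -> nat -> R) : Prop :=
  [/\ forall j, (j < m.+1)%N -> P n.+1 j = entry lam j,
      forall j, (j < m.+1)%N -> P 0%N j = entry lamb j &
      forall i, strip_step m.+1 (increment mu nu) P i].

Lemma array_rows_pattern X lam lamb mu nu : strip_concave X ->
  boundary X = (lam, lamb, mu, nu) -> skew_pattern lam lamb mu nu (array_rows X).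
Proof.
move=> Xsc [lamX lambX muX nuX].
have lowi (i : 'I_n.+1) : inord i = widen_ord (leqnSn n.+1) i :> 'I_n.+2.
  by apply: val_inj; rewrite /= inordK // ltnW // ltnS.
have lifti (i : 'I_n.+1) : inord i.+1 = lift ord0 i :> 'I_n.+2.
  by apply: val_inj; rewrite /= inordK // ltnS.
split.
- by move=> j _; rewrite /entry -lamX mxE /array_rows; congr (rowder X _ _);
    apply: val_inj; rewrite /= inordK.
- by move=> j _; rewrite /entry -lambX mxE /array_rows; congr (rowder X _ _);
    apply: val_inj; rewrite /= inordK.
move=> i; have [up down] := Xsc i; split.
  rewrite /interlace /array_rows lowi lifti; split=> [j jm|j jm]; first exact: up.
  by apply: down; rewrite !inordK // ltnW.
have sum_row k : \sum_(0 <= j < m.+1) array_rows X k j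
    = X (inord k) ord_max - X (inord k) ord0.
  have -> : \sum_(0 <= j < m.+1) array_rows X k j
    = \sum_(0 <= j < m.+1) (X (inord k) (inord j.+1) - X (inord k) (inord j)).
    apply: eq_big_nat => j /andP[_ jm]; rewrite /array_rows mxE.
    congr (X _ _ - X _ _); apply: val_inj; rewrite /= !inordK //.
    exact: leqW.
  rewrite telescope_sumr //; congr (X _ _ - X _ _); apply: val_inj;
    by rewrite /= inordK.
rewrite !sum_row /increment -nuX -muX !mxE lowi lifti; lra.
Qed.

Definition integrate mu (P : nat -> nat -> R) : 'M[R]_(n.+2, m.+2) :=
  \matrix_(i, j) (\sum_(0 <= k < i) entry mu k + \sum_(0 <= k < j) P i k).

Lemma rowder_integrate mu P i j : rowder (integrate mu P) i j = P i j.
Proof.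
by rewrite !mxE /= /bump /= add1n big_nat_recr //=; lra.
Qed.

Lemma integrate_array lam lamb mu nu P : skew_pattern lam lamb mu nu P ->
  [/\ strip_concave (integrate mu P), integrate mu P ord0 ord0 = 0 &
      boundary (integrate mu P) = (lam, lamb, mu, nu)].
Proof.
case=> Plam Plamb Pstep; split.
- move=> i; have [[up down] _] := Pstep i.
  split=> [j|j j' j'j]; rewrite !rowder_integrate /= /bump /= add1n; first exact: up.
  by rewrite j'j; apply: down; rewrite -j'j.
- by rewrite mxE !big_geq // addr0.
congr (_, _, _, _); apply/rowP => j.
- by rewrite mxE rowder_integrate -entry_ord -Plam.
- by rewrite mxE rowder_integrate -entry_ord -Plamb.
- rewrite !mxE /= /bump /= add1n big_nat_recr //= !(big_geq (leqnn 0)).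
  by rewrite entry_ord; lra.
have [_] := Pstep j; rewrite /increment => step.
rewrite !mxE /= /bump /= add1n big_nat_recr //= entry_ord; lra.
Qed.

Lemma integrate_mem (S : zmodClosed R) mu P :
  (forall i, mu 0 i \in S) ->
  (forall i j, (i <= n.+1)%N -> (j < m.+1)%N -> P i j \in S) ->
  integrate mu P \is a mxOver S.
Proof.
move=> muS PS; apply/mxOverP => i j; rewrite mxE; apply: rpredD.
  by apply: rpred_sum => k _; exact: muS.
rewrite big_nat; apply: rpred_sum => k /andP[_ kj].
by apply: PS; [rewrite -ltnS | apply: leq_trans kj _; rewrite -ltnS].
Qed.

(** For [#|I| > m] the excess is an empty sum, so a single inequality in terms
    of the excess covers both ranges of [#|I|]. *)
Lemma inequalities_excess lam lamb mu nu (I : {set 'I_n.+1}) :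
  sum_all lam - sum_all lamb + sum_all mu - sum_all nu = 0 ->
  (((#|I| <= m.+1)%N ->
     0 <= sum_seg lam 1 #|I| - sum_seg lamb (m.+1 - #|I| + 1) m.+1
          + sum_on mu I - sum_on nu I - total_deficit lam lamb #|I|) /\
   ((m.+1 < #|I|)%N ->
     0 <= sum_all lam - sum_all lamb + sum_on mu I - sum_on nu I))
  <-> excess m.+1 (entry lam) (entry lamb) (n.+1 - #|~: I|)
      <= \sum_(i in ~: I) increment mu nu i.
Proof.
move=> balance.
have -> : (n.+1 - #|~: I|)%N = #|I| by have := cardsC I; rewrite card_ord; lia.
have -> : \sum_(i in ~: I) increment mu nu i
    = sum_all lam - sum_all lamb + sum_on mu I - sum_on nu I.
  have split_sum (d : 'rV[R]_n.+1) : sum_all d = sum_on d I + sum_on d (~: I).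
    rewrite /sum_all (bigID [in I]) /=; congr (_ + _).
    by apply: eq_bigl => i; rewrite inE.
  rewrite sumrB -/(sum_on nu (~: I)) -/(sum_on mu (~: I)).
  move: balance; rewrite !(split_sum mu) !(split_sum nu); lra.
have [Im|mI] := leqP #|I| m.+1.
  have := dominance_excess lam lamb Im; split=> [[/(_ isT) + _]|]; first lra.
  by split=> // _; lra.
by rewrite /excess big_geq ?(ltnW mI) //; split=> [[_ ->]|].
Qed.

End Arrays.

Local Open Scope classical_set_scope.

Theorem corollary1 (R : realType) (n m : nat) (hn : (1 <= n)%N) (hm : (1 <= m)%N)
    (mu nu : 'rV[R]_n) (lam lamb : 'rV[R]_m)
    (hlam : weakly_decreasing lam) (hlamb : weakly_decreasing lamb)
    (hsum : sum_all lam - sum_all lamb + sum_all mu - sum_all nu = 0) :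
  ((exists X : 'M[R]_(n.+1, m.+1),
      strip_concave X /\ boundary X = (lam, lamb, mu, nu))
   <->
   (forall I : {set 'I_n},
      ((#|I| <= m)%N ->
         0 <= sum_seg lam 1 #|I| - sum_seg lamb (m - #|I| + 1) m
              + sum_on mu I - sum_on nu I - total_deficit lam lamb #|I|) /\
      ((m < #|I|)%N ->
         0 <= sum_all lam - sum_all lamb + sum_on mu I - sum_on nu I)))
  /\
  (lam \is a mxOver Num.int -> lamb \is a mxOver Num.int ->
   mu \is a mxOver Num.int -> nu \is a mxOver Num.int ->
   SC lam lamb mu nu !=set0 ->
   exists2 X, SC lam lamb mu nu X & X \is a mxOver Num.int).
Proof.
case: n hn mu nu hsum => // n _ mu nu; case: m hm lam lamb hlam hlamb => // m _.
move=> lam lamb hlam hlamb hsum.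
pose c := increment mu nu; pose u := entry lam; pose b := entry lamb.
pose admissible := forall J : {set 'I_n.+1},
  excess m.+1 u b (n.+1 - #|J|) <= \sum_(i in J) c i.
have before_all : before n.+1 n.+1 = setT.
  by apply/setP => i; rewrite !inE ltn_ord.
have array_admissible X : strip_concave X ->
    boundary X = (lam, lamb, mu, nu) -> admissible.
  move=> Xsc /(array_rows_pattern Xsc) [Plam Plamb Pstep] J.
  have := pattern_excess (leqnn n.+1) (fun i _ => Pstep i).
  rewrite before_all => /(_ J (subsetT _)); apply: le_trans.
  rewrite le_eqVlt; apply/orP; left; apply/eqP; apply: eq_big_nat => j /andP[_ jm].
  by rewrite Plam // Plamb //; exact: leq_ltn_trans (leq_subr _ _) jm.
have admissible_array : admissible ->
    exists P, skew_pattern lam lamb mu nu P /\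
    (lam \is a mxOver Num.int -> lamb \is a mxOver Num.int ->
     mu \is a mxOver Num.int -> nu \is a mxOver Num.int ->
     integrate m mu P \is a mxOver Num.int).
  move=> adm.
  have csum : \sum_(0 <= j < m.+1) u j - \sum_(0 <= j < m.+1) b j
      = \sum_(i in before n.+1 n.+1) c i.
    rewrite before_all -!sum_allE.
    rewrite (eq_bigl xpredT) => [|i]; last by rewrite inE.
    by rewrite sumrB; move: hsum; rewrite /sum_all; lra.
  have [P [Pn P0 Pstep PS]] := pattern_exists
    (GRing.ZmodClosed.clone R (@Num.int_num_subdef R) _)
    (decreasing_entry hlamb) (leqnn n.+1) (decreasing_entry hlam) csum
    (fun J _ => adm J).
  exists P; split; first by split=> [j _||i]; [rewrite Pn | exact: P0 | exact: Pstep].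
  move=> /mxOverP lamS /mxOverP lambS /mxOverP muS /mxOverP nuS.
  apply: integrate_mem => [i|]; first exact: muS.
  by apply: PS => [j _|j _|i]; [exact: lamS | exact: lambS | exact: rpredB].
split; first split.
- case=> X [Xsc Xb] I; apply/(inequalities_excess I hsum).
  exact: (array_admissible X Xsc Xb (~: I)).
- move=> ineq; have [|P [/integrate_array[Xsc _ Xb] _]] := admissible_array.
    move=> J; have := ineq (~: J); rewrite (inequalities_excess _ hsum).
    by rewrite setCK.
  by exists (integrate m mu P).
move=> lamS lambS muS nuS [X [[Xsc _] Xb]].
have [P [/integrate_array[Psc P00 Pb] PS]] :=
  admissible_array (array_admissible X Xsc Xb).
by exists (integrate m mu P); [split | exact: PS].
Qed.
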